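(* Let $q$ be an odd prime power and $\mathcal{E}\subseteq\mathbb{F}_q^d$. \begin{itemize} \item If $q\geq5$, $d\in\{2,4\}$, $r\in\mathbb{F}_q^*$ and $|\mathcal{E}|\geq 36q^{(2d+1)/3}$, then $\mathcal{E}$ contains a pair of $4$-paths with dilation ratio $r$. \item If $d=3$, $r\in\mathbb{F}_q^+$ and $|\mathcal{E}|\geq 9q^{(2d+1)/3}$, then $\mathcal{E}$ contains a pair of $4$-paths with dilation ratio $r$. \item If $d=5$, $r\in\mathbb{F}_q^+$ and $|\mathcal{E}|\geq 12q^{3}$, then $\mathcal{E}$ contains a pair of $4$-paths with dilation ratio $r$. \item If $q\geq5$, $d\geq6$ is even, $r\in\mathbb{F}_q^*$ and $|\mathcal{E}|\geq 313q^{d/2}$, then $\mathcal{E}$ contains a pair of $4$-paths with dilation ratio $r$. \item If $d\geq7$ is odd, $r\in\mathbb{F}_q^+$ and $|\mathcal{E}|\geq 313q^{d/2}$, then $\mathcal{E}$ contains a pair of $4$-paths with dilation ratio $r$. \end{itemize}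
   Context: $\mathbb{F}_q$ is the finite field with $q$ elements, $\mathbb{F}_q^*$ its nonzero elements, and $\mathbb{F}_q^+$ the set of nonzero quadratic residues (nonzero squares) in $\mathbb{F}_q$. For $\bm{x}=(x_1,\ldots,x_d)\in\mathbb{F}_q^d$, $\|\bm{x}\|:=x_1^2+\cdots+x_d^2$. Let $G=(V,E)$ be a graph with $V=\{1,\ldots,n\}$ and $E\subseteq\binom{V}{2}$. A set $\mathcal{E}\subseteq\mathbb{F}_q^d$ contains a pair of $G$ with dilation ratio $r$ if there exist distinct $\bm{x}_1,\ldots,\bm{x}_n\in\mathcal{E}$ and distinct $\bm{y}_1,\ldots,\bm{y}_n\in\mathcal{E}$ such that $\|\bm{y}_i-\bm{y}_j\|=r\|\bm{x}_i-\bm{x}_j\|\neq0$ whenever $\{i,j\}\in E$. A $4$-path is the graph with vertex set $\{1,2,3,4,5\}$ and edge set $\{\{1,2\},\{2,3\},\{3,4\},\{4,5\}\}$. *)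

(* Defs.v *)
From HB Require Import structures.
From mathcomp Require Import all_boot all_order all_algebra all_field.
From Stdlib Require Reals.
Set Implicit Arguments. Unset Strict Implicit. Unset Printing Implicit Defensive.
Import GRing.Theory.
Local Open Scope ring_scope.

Definition sqnorm (F : fieldType) (d : nat) (x : 'rV[F]_d) : F :=
  \sum_(i < d) (x ord0 i) ^+ 2.

Definition nz_square (F : fieldType) (r : F) : Prop :=
  r != 0 /\ exists y : F, r = y ^+ 2.

(* A graph on vertex set {1,...,n}, represented by 'I_n, with edge set given
   by a symmetric relation [edge]; "E contains a pair of G with dilation ratio r". *)
Definition contains_pair (F : finFieldType) (d n : nat) (E : {set 'rV[F]_d})
    (edge : rel 'I_n) (r : F) : Prop :=
  exists (x y : 'I_n -> 'rV[F]_d),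
    [/\ injective x, injective y,
        (forall i, x i \in E /\ y i \in E) &
        (forall i j : 'I_n, edge i j ->
           sqnorm (y i - y j) = r * sqnorm (x i - x j) /\
           sqnorm (x i - x j) != 0)].

Definition path4_edge : rel 'I_5 :=
  fun i j => ((i : nat).+1 == j) || ((j : nat).+1 == i).

Definition contains_4path_pair (F : finFieldType) (d : nat) (E : {set 'rV[F]_d})
    (r : F) : Prop := contains_pair E path4_edge r.

Definition size_ge (n c q num den : nat) : Prop :=
  Reals.Rdefinitions.Rle
    (Reals.Rdefinitions.Rmult (Reals.Raxioms.INR c)
       (Reals.Rpower.Rpower (Reals.Raxioms.INR q)
          (Reals.Rdefinitions.Rdiv (Reals.Raxioms.INR num) (Reals.Raxioms.INR den))))
    (Reals.Raxioms.INR n).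

(* Main.v *)
(** Write [n] for the size of [E], [q] for the size of [F], [nu t] for the number of
    pairs in [E^2] at distance [t], and join [(x, y)] to [(x', y')] in [E^2] when
    [||y - y'|| = r ||x - x'|| <> 0].  A path on five vertices of this graph with
    distinct first and distinct second coordinates is what is wanted.

    The graph has [M = (\sum_t nu t * nu (r t)) - nu 0 ^ 2] ordered edges.  For an
    additive character [psi], completing the square turns [\sum_t nu t * psi (s t)] into
    a Gauss sum to the power [d] times the transform of the spectral mass
    [a t = \sum_(||m|| = t) |\sum_(x in E) psi (m . x)|^2 >= 0].  When [d] is even or
    [r] is a square the Gauss sums in the correlation cancel to a positive power of [q],
    so the spectral side of the correlation is nonnegative.  In even dimension [nu 0]
    may be as large as the correlation allows (isotropic subspaces), but the dangerous
    part of [nu 0 ^ 2] is exactly the term [a 0 ^ 2] of the spectral side.  The outcome is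
    [2 q M >= n^4] as soon as [n^2 >= 400 q^d], which all five size assumptions imply.

    The average degree is then at least [200 q^(d-1)], while a sphere has at most
    [2 q^(d-1)] points, so in a subgraph of large minimum degree a path can be extended
    greedily while avoiding all coordinates already used. *)
Require Import Defs.
From HB Require Import structures.
From mathcomp Require Import all_boot all_order all_algebra all_field.
From mathcomp Require Import all_fingroup all_character.
From mathcomp Require Import ring lra zify.
From Stdlib Require Reals.
Set Implicit Arguments. Unset Strict Implicit. Unset Printing Implicit Defensive.
Import Order.TTheory GRing.Theory Num.Theory.
Local Open Scope ring_scope.

(** * Gauss sums over a finite field *)

Lemma odd_card_two_neq0 (F : finFieldType) : odd #|F| -> 2%:R != 0 :> F.
Proof.
move=> oddF; apply/eqP => two0.
have /eqP : (#|F|%:R : F) = 0.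
  have /= := cyclic.expg_cardG (in_setT (1 : F)).
  by rewrite cardsT FinRing.zmodXgE.
rewrite -(odd_double_half #|F|) oddF -muln2 natrD natrM two0 mulr0 addr0.
by rewrite oner_eq0.
Qed.

Lemma card_sqrt_le2 (F : finFieldType) (c : F) :
  (#|[set x : F | x ^+ 2 == c]| <= 2)%N.
Proof.
case: (set_0Vmem [set x : F | x ^+ 2 == c]) => [-> | [a]]; first by rewrite cards0.
rewrite inE => /eqP ac; apply: leq_trans (_ : #|[set a; - a]| <= 2)%N.
  apply: subset_leq_card; apply/subsetP => x.
  by rewrite !inE -ac eqf_sqr.
by rewrite cards2; case: (_ != _).
Qed.

(** Pigeonhole: the squares and the elements [c - y] with [y] a square each fill more than half of
    the field, so the two sets meet. *)
Lemma sum_two_squares (F : finFieldType) (c : F) :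
  odd #|F| -> exists a b : F, c = a ^+ 2 + b ^+ 2.
Proof.
move=> oddF.
pose A := [set x ^+ 2 | x : F]; pose B : {set F} := [set c - y | y in A].
have cardA : (#|F| < 2 * #|A|)%N.
  (* Squaring is at most two-to-one, and the oddness of [#|F|] makes the resulting inequality
     strict. *)
  suff : (#|F| <= 2 * #|A|)%N by move: oddF; lia.
  rewrite -[leqLHS]sum1_card (partition_big (fun x => x ^+ 2) (mem A)) /=; last first.
    by move=> x _; apply: imset_f.
  have -> : (2 * #|A| = \sum_(y in A) 2)%N by rewrite sum_nat_const mulnC.
  apply: leq_sum => y _.
  by rewrite sum1_card -cardsE card_sqrt_le2.
have cardB : #|B| = #|A| by apply: card_imset => x y /addrI/oppr_inj.
have : (0 < #|A :&: B|)%N.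
  have aux (n k u i : nat) : (u + i = k + k -> u <= n -> n < 2 * k -> 0 < i)%N.
    by lia.
  by have := cardsUI A B; rewrite cardB => /aux; apply; [exact: max_card|].
case/card_gt0P => x; rewrite inE => /andP[/imsetP[a _ xa] /imsetP[y /imsetP[b _ ->] xb]].
by exists a, b; rewrite -xa xb subrK.
Qed.

(** The additive group is abelian, so its irreducible characters are linear and there are [#|F| > 1]
    of them; a non-principal one is taken. *)
Lemma additive_character_exists (F : finFieldType) :
  exists psi : F -> algC,
    [/\ {morph psi : x y / x + y >-> x * y}, psi 0 = 1,
        (forall x, psi (- x) = (psi x)^*) & exists c, psi c != 1].
Proof.
have abF : abelian [set: F] by exact: FinRing.zmod_abelian.
have lin := char_abelianP _ abF.
have N1 : (1 < Nirr [set: F])%N.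
  rewrite NirrE; move: abF; rewrite card_classes_abelian => /eqP ->.
  by rewrite cardsT finRing_gt1.
pose i : Iirr [set: F] := Ordinal N1.
exists (fun x => 'chi_i x); split.
- by move=> x y; rewrite -FinRing.zmodMgE lin_charM ?inE.
- by rewrite -FinRing.zmod1gE lin_char1.
- by move=> x; rewrite -FinRing.zmodVgE lin_charV_conj ?inE.
have chiN0 : 'chi_i != 'chi_0 by rewrite (inj_eq irr_inj).
apply/existsP; rewrite -negb_forall; apply: contra chiN0 => /forallP h.
by apply/eqP/cfunP => x; rewrite irr0 cfun1E inE; apply/eqP/h.
Qed.

Section AdditiveCharacter.

Variables (F : finFieldType) (psi : F -> algC).
Hypotheses (oddF : odd #|F|) (psiD : {morph psi : x y / x + y >-> x * y}).
Hypotheses (psi0 : psi 0 = 1) (psi_nontrivial : exists c, psi c != 1).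

Let q : algC := #|F|%:R.

Lemma sum_character (t : F) : \sum_(s : F) psi (s * t) = (t == 0)%:R * q.
Proof.
have [->|t0] := eqVneq.
  by under eq_bigr do rewrite mulr0 psi0; rewrite sumr_const mul1r.
rewrite mul0r; transitivity (\sum_(x : F) psi x).
  by rewrite [RHS](reindex_inj (mulIf t0)).
have [c c1] := psi_nontrivial.
have : \sum_(x : F) psi x = psi c * \sum_(x : F) psi x.
  rewrite {1}(reindex_inj (addrI c)) mulr_sumr.
  by apply: eq_bigr => x _; rewrite psiD.
move/eqP; rewrite -subr_eq0 -{1}[\sum_x _]mul1r -mulrBl mulf_eq0 subr_eq0 eq_sym.
by rewrite (negbTE c1) => /eqP.
Qed.

Definition fourier (f : F -> algC) (s : F) : algC := \sum_(t : F) f t * psi (s * t).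

Lemma fourier0 f : fourier f 0 = \sum_t f t.
Proof. by apply: eq_bigr => t _; rewrite mul0r psi0 mulr1. Qed.

Lemma sum_fourier f : \sum_s fourier f s = q * f 0.
Proof.
rewrite exchange_big /= (bigD1 0) //= -mulr_sumr sum_character eqxx mul1r mulrC.
rewrite big1 ?addr0 // => t t0.
by rewrite -mulr_sumr sum_character (negbTE t0) mul0r mulr0.
Qed.

(** Orthogonality of characters in [s] isolates [t' = r * t], which explains the dilation in one
    factor and the sign in the other. *)
Lemma fourier_parseval f h (r : F) :
  \sum_s fourier f (r * s) * fourier h (- s) = q * \sum_t f t * h (r * t).
Proof.
under eq_bigr do rewrite /fourier big_distrlr /=.
rewrite exchange_big mulr_sumr; apply: eq_bigr => t _.
rewrite exchange_big (bigD1 (r * t)) //= [X in _ + X]big1 => [|t' t'r]; last first.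
  transitivity (\sum_(s : F) f t * h t' * psi (s * (r * t - t'))).
    by apply: eq_bigr => s _; rewrite mulrACA -psiD; congr (_ * psi _); ring.
  rewrite -mulr_sumr sum_character subr_eq0 eq_sym (negbTE t'r).
  by rewrite mul0r mulr0.
rewrite addr0.
transitivity (\sum_(s : F) f t * h (r * t)); last first.
  by rewrite sumr_const mulr_natl.
by apply: eq_bigr => s _; rewrite mulrACA -psiD -[RHS]mulr1 -psi0;
  congr (_ * psi _); ring.
Qed.

Definition gauss (u : F) : algC := \sum_(x : F) psi (u * x ^+ 2).

Let two0 : 2%:R != 0 :> F. Proof. exact: odd_card_two_neq0. Qed.
Let four0 : 4%:R != 0 :> F.
Proof. by rewrite (natrM _ 2 2) mulf_neq0. Qed.

Lemma gauss_shift (u v : F) : u != 0 ->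
  \sum_(x : F) psi (u * x ^+ 2 + x * v) = psi (- (4%:R * u)^-1 * v ^+ 2) * gauss u.
Proof.
move=> u0; rewrite (reindex_inj (addIr (- (2%:R * u)^-1 * v))) mulr_sumr.
apply: eq_bigr => x _; rewrite -psiD; congr psi.
by field; rewrite u0 two0 four0.
Qed.

(** Translating one variable by the other cancels the quadratic terms in [y]; what remains in [y] is
    a character sum that vanishes unless [z = 0]. *)
Lemma gaussN (u : F) : u != 0 -> gauss u * gauss (- u) = q.
Proof.
move=> u0; rewrite /gauss mulrC big_distrlr /=.
transitivity (\sum_(y : F) \sum_(z : F) psi (u * z ^+ 2) * psi (y * (2%:R * u * z))).
  apply: eq_bigr => y _; rewrite (reindex_inj (addIr y)).
  by apply: eq_bigr => z _; rewrite -!psiD; congr psi; ring.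
rewrite exchange_big (bigD1 0) //= -mulr_sumr sum_character mulr0 eqxx.
rewrite expr0n mulr0 psi0 !mul1r big1 ?addr0 // => z z0.
by rewrite -mulr_sumr sum_character !mulf_eq0 (negbTE z0) (negbTE two0) (negbTE u0) mul0r mulr0.
Qed.

Lemma gauss_mul_square (u b : F) : b != 0 -> gauss (u * b ^+ 2) = gauss u.
Proof.
move=> b0; rewrite /gauss [RHS](reindex_inj (mulfI b0)).
by apply: eq_bigr => x _; rewrite exprMn -mulrA.
Qed.

(* A sum of two squares [c] is the factor of a similarity of the plane, which
   permutes the terms of [gauss u ^+ 2]. *)
Lemma gauss_sqr_mul (u c : F) : c != 0 -> gauss (u * c) ^+ 2 = gauss u ^+ 2.
Proof.
have [a [b ->]] := sum_two_squares c oddF => c0.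
rewrite !expr2 /gauss !big_distrlr /= !pair_big /=.
pose h (z : F * F) := (a * z.1 + b * z.2, a * z.2 - b * z.1).
have h_inj : injective h.
  apply: (can_inj (g := fun z => ((a * z.1 - b * z.2) / (a ^+ 2 + b ^+ 2),
     (b * z.1 + a * z.2) / (a ^+ 2 + b ^+ 2)))).
  by case=> x y; rewrite /h /=; congr pair; field.
rewrite [RHS](reindex_inj h_inj); apply: eq_bigr => -[x y] _ /=.
by rewrite -!psiD; congr psi; ring.
Qed.

Lemma gauss_sqr_const (u : F) : u != 0 -> gauss u ^+ 2 = gauss 1 ^+ 2.
Proof. by move=> u0; rewrite -(gauss_sqr_mul 1 u0) mul1r. Qed.

(** Since [gauss (-1)] and [gauss 1] have the same square, [gaussN] at [1] yields
    [gauss 1 ^+ 4 = q ^+ 2]. *)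
Lemma gauss_sqr_sign : (gauss 1 ^+ 2 == q) || (gauss 1 ^+ 2 == - q).
Proof.
rewrite -eqf_sqr expr2 -{2}(gauss_sqr_const (_ : -1 != 0)) ?oppr_eq0 ?oner_eq0 //.
by rewrite -exprMn gaussN ?oner_eq0.
Qed.


(** * Exponential sums over row vectors *)

Lemma psi_sum (I : finType) (f : I -> F) : psi (\sum_i f i) = \prod_i psi (f i).
Proof. exact: (big_morph psi psiD psi0). Qed.

Lemma sum_row_prod d (f : 'I_d -> F -> algC) :
  \sum_(m : 'rV[F]_d) \prod_i f i (m ord0 i) = \prod_i \sum_(x : F) f i x.
Proof.
rewrite bigA_distr_bigA /=.
rewrite (reindex (fun g : {ffun 'I_d -> F} => \row_i g i)) /=; last first.
  exists (fun m : 'rV_d => [ffun i => m ord0 i]) => [g|m] _.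
    by apply/ffunP => i; rewrite ffunE mxE.
  by apply/rowP => i; rewrite mxE ffunE.
by apply: eq_bigr => g _; apply: eq_bigr => i _; rewrite mxE.
Qed.

Definition dot d (m v : 'rV[F]_d) : F := \sum_i m ord0 i * v ord0 i.

Lemma dotBr d (m v w : 'rV[F]_d) : dot m (v - w) = dot m v - dot m w.
Proof. by rewrite -sumrB; apply: eq_bigr => i _; rewrite !mxE mulrBr. Qed.

Lemma sum_character_row d (v : 'rV[F]_d) :
  \sum_m psi (dot m v) = (v == 0)%:R * q ^+ d.
Proof.
under eq_bigr do rewrite psi_sum.
rewrite (sum_row_prod (fun i x => psi (x * v ord0 i))).
under eq_bigr do rewrite sum_character.
have [->|v0] := eqVneq.
  under eq_bigr do rewrite mxE eqxx mul1r.
  by rewrite prodr_const card_ord mul1r.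
rewrite mul0r; apply/eqP/prodf_eq0.
have [i vi] : exists i, v ord0 i != 0.
  apply/existsP; rewrite -negb_forall; apply: contra v0 => /forallP h.
  by apply/eqP/rowP => i; rewrite mxE; apply/eqP.
by exists i => //; rewrite (negbTE vi) mul0r.
Qed.

Lemma gauss_row d u (v : 'rV[F]_d) : u != 0 ->
  \sum_m psi (u * sqnorm m + dot m v) =
  gauss u ^+ d * psi (- (4%:R * u)^-1 * sqnorm v).
Proof.
move=> u0; rewrite {2}/sqnorm mulr_sumr psi_sum /=.
transitivity (\prod_(i < d) \sum_(x : F) psi (u * x ^+ 2 + x * v ord0 i)).
  rewrite -(sum_row_prod (fun i x => psi (u * x ^+ 2 + x * v ord0 i))).
  by apply: eq_bigr => m _; rewrite -psi_sum big_split /= -mulr_sumr.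
rewrite (eq_bigr _ (fun i _ => gauss_shift (v ord0 i) u0)).
by rewrite big_split /= prodr_const card_ord mulrC.
Qed.

End AdditiveCharacter.

(** * Correlation of the distance counts *)

Definition distance_count (F : finFieldType) d (E : {set 'rV[F]_d}) (t : F) : nat :=
  \sum_(x in E) \sum_(y in E) (sqnorm (x - y) == t).

Section SpectralEstimates.

Variables (F : finFieldType) (psi : F -> algC).
Hypotheses (oddF : odd #|F|) (psiD : {morph psi : x y / x + y >-> x * y}).
Hypotheses (psi0 : psi 0 = 1) (psi_nontrivial : exists c, psi c != 1).
Hypothesis psiN : forall x, psi (- x) = (psi x)^*.
Variables (d : nat) (E : {set 'rV[F]_d}).

Let q : algC := #|F|%:R.
Let n : algC := #|E|%:R.
Let four0 : 4%:R != 0 :> F.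
Proof. by rewrite (natrM _ 2 2) mulf_neq0 ?odd_card_two_neq0. Qed.

Let nu (t : F) : algC := (distance_count E t)%:R.
Local Notation fourier := (fourier psi).
Local Notation gauss := (gauss psi).

Let gaussNq u : u != 0 -> gauss u * gauss (- u) = q.
Proof. exact: gaussN. Qed.

Lemma fourier_distance s :
  fourier nu s = \sum_(x in E) \sum_(y in E) psi (s * sqnorm (x - y)).
Proof.
rewrite /fourier /nu /distance_count.
under eq_bigr do rewrite natr_sum mulr_suml.
rewrite exchange_big; apply: eq_bigr => x _.
under eq_bigr do rewrite natr_sum mulr_suml.
rewrite exchange_big; apply: eq_bigr => y _ /=.
rewrite (bigD1 (sqnorm (x - y))) //= eqxx mul1r big1 ?addr0 // => t.
by rewrite eq_sym => /negbTE ->; rewrite mul0r.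
Qed.

Lemma fourier_distance0 : fourier nu 0 = n ^+ 2.
Proof.
rewrite fourier_distance; under eq_bigr do under eq_bigr do rewrite mul0r psi0.
under eq_bigr do rewrite sumr_const.
by rewrite sumr_const -mulr_natl expr2.
Qed.

Definition spectral_mass (t : F) : algC :=
  \sum_(m : 'rV[F]_d | sqnorm m == t) `|\sum_(x in E) psi (dot m x)| ^+ 2.

Lemma spectral_mass_ge0 t : 0 <= spectral_mass t.
Proof. by apply: sumr_ge0 => m _; rewrite exprn_ge0. Qed.

Lemma fourier_mass u : fourier spectral_mass u =
  \sum_(x in E) \sum_(y in E) \sum_m psi (u * sqnorm m + dot m (x - y)).
Proof.
transitivity (\sum_m \sum_(x in E) \sum_(y in E) psi (u * sqnorm m + dot m (x - y))).
  rewrite [RHS](partition_big (@sqnorm F d) predT) //=; apply: eq_bigr => t _.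
  rewrite mulr_suml; apply: eq_bigr => m /eqP <-.
  rewrite normCK rmorph_sum big_distrlr mulr_suml; apply: eq_bigr => x _ /=.
  rewrite mulr_suml; apply: eq_bigr => y _.
  by rewrite -psiN -!psiD dotBr addrC.
rewrite exchange_big; apply: eq_bigr => x _.
by rewrite exchange_big.
Qed.

Lemma fourier_mass0 : fourier spectral_mass 0 = q ^+ d * n.
Proof.
rewrite fourier_mass.
under eq_bigr => x xE.
  under eq_bigr do under eq_bigr do rewrite mul0r add0r.
  under eq_bigr do rewrite sum_character_row // subr_eq0.
  rewrite (bigD1 x) //= eqxx mul1r big1 ?addr0; last first.
    by move=> y /andP[_]; rewrite eq_sym => /negbTE ->; rewrite mul0r.
  over.
by rewrite sumr_const mulr_natr.
Qed.

Lemma sum_spectral_mass : \sum_t spectral_mass t = q ^+ d * n.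
Proof. by rewrite -fourier_mass0 fourier0. Qed.

(** For fixed [x] and [y] the sum over [m] is a Gauss sum in [d] variables; completing the square
    turns the frequency [u] into [- (4 u)^-1]. This is the duality between distances and
    spectrum. *)
Lemma fourier_mass_distance u : u != 0 ->
  fourier spectral_mass u = gauss u ^+ d * fourier nu (- (4%:R * u)^-1).
Proof.
move=> u0; rewrite fourier_mass fourier_distance mulr_sumr.
apply: eq_bigr => x _; rewrite mulr_sumr.
by apply: eq_bigr => y _; rewrite gauss_row.
Qed.

(** Parseval is applied on both sides. The terms of frequency 0 are [n ^+ 4] and
    [(q ^+ d * n) ^+ 2]; the others correspond under [s = - (4 r u)^-1], where the Gauss factors
    [gauss (- u) ^+ d] and [gauss u ^+ d] multiply to [q ^+ d]. *)
Lemma distance_correlation (r : F) : r != 0 ->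
    (forall u : F, u != 0 -> gauss (r * u) ^+ d = gauss u ^+ d) ->
  q ^+ d * (q * \sum_t nu t * nu (r * t) - n ^+ 4) =
  q * \sum_t spectral_mass t * spectral_mass (r * t) - (q ^+ d * n) ^+ 2.
Proof.
move=> r0 gr; rewrite -!(fourier_parseval psiD psi0 psi_nontrivial).
rewrite (bigD1 0) //= mulr0 oppr0 fourier_distance0 addrC -exprD addrK.
rewrite [in RHS](reindex_inj oppr_inj) [in RHS](bigD1 0) //=.
rewrite oppr0 mulr0 oppr0 fourier_mass0 -expr2 addrC addrK.
have h_inj : injective (fun u : F => - (4%:R * r * u)^-1).
  by move=> u v /oppr_inj/invr_inj/mulfI; apply; rewrite mulf_neq0.
rewrite (reindex_inj h_inj) mulr_sumr; apply: eq_big => u /=.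
  by rewrite oppr_eq0 invr_eq0 !mulf_eq0 (negbTE r0) (negbTE four0).
rewrite oppr_eq0 invr_eq0 !mulf_eq0 (negbTE r0) (negbTE four0) /= => u0.
rewrite !opprK [in RHS]fourier_mass_distance ?mulf_neq0 ?oppr_eq0 // fourier_mass_distance //.
rewrite gr ?oppr_eq0 // -(gaussNq u0) exprMn.
have -> : r * - (4%:R * r * u)^-1 = - (4%:R * u)^-1 by field; rewrite four0 r0 u0.
have -> : - (4%:R * (r * - u))^-1 = (4%:R * r * u)^-1 
  by field; rewrite oppr_eq0 four0 r0 u0.
by ring.
Qed.

(** Fourier inversion at distance 0, with the term [n ^+ 2] of frequency 0 removed and the other
    frequencies written as [- (4 u)^-1]. *)
Lemma null_distance_sum :
  q ^+ d * (q * nu 0 - n ^+ 2) = \sum_(u | u != 0) gauss (- u) ^+ d * fourier spectral_mass u.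
Proof.
rewrite -(sum_fourier psiD psi0 psi_nontrivial) (bigD1 0) //= fourier_distance0.
rewrite addrC addrK.
have h_inj : injective (fun u : F => - (4%:R * u)^-1).
  by move=> u v /oppr_inj/invr_inj/mulfI; apply.
rewrite (reindex_inj h_inj) mulr_sumr; apply: eq_big => u /=.
  by rewrite oppr_eq0 invr_eq0 mulf_eq0 (negbTE four0).
rewrite oppr_eq0 invr_eq0 mulf_eq0 (negbTE four0) /= => u0.
rewrite fourier_mass_distance // -(gaussNq u0) exprMn.
by ring.
Qed.

End SpectralEstimates.

(** * Lower bounds for the number of quadruples *)

Definition quadruple_count (F : finFieldType) d (E : {set 'rV[F]_d}) (r : F) : nat :=
  \sum_t distance_count E t * distance_count E (r * t)%R.

Lemma natr_quadruple_count (F : finFieldType) d (E : {set 'rV[F]_d}) (r : F) :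
  (quadruple_count E r)%:R =
  \sum_t (distance_count E t)%:R * (distance_count E (r * t))%:R :> algC.
Proof. by rewrite natr_sum; apply: eq_bigr => t _; rewrite natrM. Qed.

(** All powers [gauss u ^+ (2 * k)] with [u != 0] equal [e * q ^+ k] for one sign [e]. Hence
    [q ^+ k * n + e * z] is [q / q ^+ k] times the spectral mass at 0, which lies between 0 and the
    total mass. The last inequality keeps only the square of this mass on the spectral side. *)
Lemma quadruple_count_even (F : finFieldType) k (E : {set 'rV[F]_(2 * k)}) (r : F)
    (q := #|F|%:Z) (n := #|E|%:Z) (z := q * (distance_count E 0)%:Z - n ^+ 2) :
  odd #|F| -> r != 0 ->
  exists e : int, [/\ e ^+ 2 = 1, 0 <= q ^+ k * n + e * z,
    q ^+ k * n + e * z <= q * (q ^+ k * n) &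
    (q ^+ k * n + e * z) ^+ 2 - (q ^+ k) ^+ 2 * q * n ^+ 2
      <= q * (q * (quadruple_count E r)%:Z - n ^+ 4)].
Proof.
move=> oddF r0; have [psi [psiD psi0 psiN nontriv]] := additive_character_exists F.
have [e0 [e02 G]] : exists e0 : int, e0 ^+ 2 = 1 /\ gauss psi 1 ^+ 2 = e0%:~R * #|F|%:R.
  case/orP: (gauss_sqr_sign oddF psiD psi0 nontriv) => /eqP ->.
    by exists 1; rewrite expr1n mul1r.
  by exists (-1); rewrite sqrrN expr1n mulrN1z mulNr mul1r.
pose e := e0 ^+ k; have e2 : e ^+ 2 = 1 by rewrite -exprM mulnC exprM e02 expr1n.
pose Q : algC := #|F|%:R; pose N : algC := #|E|%:R; pose K := Q ^+ k.
pose Z : algC := Q * (distance_count E 0)%:R - N ^+ 2; pose eC : algC := e%:~R.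
pose A := spectral_mass psi E 0.
have Q_gt0 : 0 < Q by rewrite ltr0n (leq_trans _ (finRing_gt1 F)).
have K_gt0 : 0 < K by rewrite exprn_gt0.
have Qd : Q ^+ (2 * k) = K ^+ 2 by rewrite mulnC exprM.
have eC2 : eC ^+ 2 = 1 by rewrite -rmorphXn e2.
have gauss_d (u : F) : u != 0 -> gauss psi u ^+ (2 * k) = eC * K.
  by move=> u0; rewrite exprM gauss_sqr_const // G exprMn -rmorphXn.
clearbody e.
have QA : Q * A = K * (K * N + eC * Z).
  have := null_distance_sum oddF psiD psi0 nontriv psiN E.
  rewrite -/Q Qd (eq_bigr (fun u => eC * K * fourier psi (spectral_mass psi E) u)); last first.
    by move=> u u0; rewrite gauss_d ?oppr_eq0.
  rewrite -mulr_sumr; have := sum_fourier psiD psi0 nontriv (spectral_mass psi E).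
  rewrite (bigD1 0) //= fourier_mass0 // -/Q -/N -/A Qd => /(canRL (addKr _)) ->.
  rewrite -/Z => KZ; apply: (mulfI (lt0r_neq0 K_gt0)).
  have -> : K * (K * (K * N + eC * Z)) = K ^+ 3 * N + eC * (K ^+ 2 * Z) by ring.
  rewrite KZ -!(mulrA eC) (mulrA eC eC) -expr2 eC2; ring.
have A_ge0 : 0 <= A by exact: spectral_mass_ge0.
have A_le : A <= K ^+ 2 * N.
  rewrite -Qd -(sum_spectral_mass psiD psi0 nontriv psiN) (bigD1 0) //= lerDl.
  by apply: sumr_ge0 => t _; apply: spectral_mass_ge0.
have corr : Q * A ^+ 2 - (K ^+ 2 * N) ^+ 2 <= K ^+ 2 * (Q * (quadruple_count E r)%:R - N ^+ 4).
  have := distance_correlation oddF psiD psi0 nontriv psiN E r0.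
  rewrite -/Q -/N Qd natr_quadruple_count => ->; last first.
    by move=> u u0; rewrite !gauss_d ?mulf_neq0.
  rewrite lerD2r ler_pM2l // (bigD1 0) //= mulr0 -expr2 lerDl.
  by apply: sumr_ge0 => t _; rewrite mulr_ge0 ?spectral_mass_ge0.
have qE : q%:~R = Q by []. have nE : n%:~R = N by [].
have zE : z%:~R = Z by rewrite rmorphB rmorphM rmorphXn.
clearbody z n q.
exists e; split=> //; rewrite -(ler_int algC) !(rmorphXn, rmorphD, rmorphN, rmorphM) /=
  zE qE nE -/eC -/K ?rmorph0.
- by rewrite -(pmulr_rge0 _ K_gt0) -QA mulr_ge0 // ltW.
- rewrite -(ler_pM2l K_gt0) -QA mulrCA ler_pM2l //.
  by rewrite mulrA -expr2.
rewrite -(ler_pM2l (exprn_gt0 2 K_gt0)).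
have -> : K ^+ 2 * ((K * N + eC * Z) ^+ 2 - K ^+ 2 * Q * N ^+ 2) =
   Q * (Q * A ^+ 2 - (K ^+ 2 * N) ^+ 2).
  have -> : Q * (Q * A ^+ 2 - (K ^+ 2 * N) ^+ 2) = (Q * A) ^+ 2 - Q * (K ^+ 2 * N) ^+ 2.
    by ring.
  by rewrite QA; ring.
by rewrite [leRHS]mulrCA ler_pM2l.
Qed.

(** In odd dimension one Gauss sum stays unpaired and its cancellation bounds [z] by the total
    spectral mass. The second bound drops the whole nonnegative spectral side; [r] being a square
    gives [gauss (r * u) = gauss u]. *)
Lemma quadruple_count_odd (F : finFieldType) k (E : {set 'rV[F]_(2 * k).+1}) (r : F)
    (q := #|F|%:Z) (n := #|E|%:Z) (z := q * (distance_count E 0)%:Z - n ^+ 2) :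
  odd #|F| -> nz_square r ->
  [/\ `|z| <= q ^+ k.+1 * n &
    n ^+ 4 - q * (q ^+ k) ^+ 2 * n ^+ 2 <= q * (quadruple_count E r)%:Z].
Proof.
move=> oddF [r0 [b rb]]; have [psi [psiD psi0 psiN nontriv]] := additive_character_exists F.
have b0 : b != 0 by apply: contraNneq r0 => b0; rewrite rb b0 expr0n.
pose Q : algC := #|F|%:R; pose N : algC := #|E|%:R; pose K := Q ^+ k.
pose Z : algC := Q * (distance_count E 0)%:R - N ^+ 2.
have Q_gt0 : 0 < Q by rewrite ltr0n (leq_trans _ (finRing_gt1 F)).
have K_gt0 : 0 < K by rewrite exprn_gt0.
have Qd : Q ^+ (2 * k).+1 = Q * K ^+ 2 by rewrite exprS mulnC exprM.
have two0 := odd_card_two_neq0 oddF.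
have qE : q%:~R = Q by []. have nE : n%:~R = N by [].
have zE : z%:~R = Z by rewrite rmorphB rmorphM rmorphXn.
clearbody z n q.
split; rewrite -(ler_int algC) ?intr_norm !(rmorphXn, rmorphD, rmorphN, rmorphM) /= ?zE qE nE.
  (* Expanding the unpaired Gauss sum and summing over [u != 0] leaves the number of square roots of
     [t] minus 1 as coefficient: one of -1, 0, 1. *)
  have sumZ : Q * K ^+ 2 * Z = (gauss psi 1 ^+ 2) ^+ k * (Q *
      \sum_t spectral_mass psi E t * (#|[set x : F | x ^+ 2 == t]|%:R - 1)).
    have := null_distance_sum oddF psiD psi0 nontriv psiN E.
    rewrite -/Q Qd -/N -/Z => ->.
    transitivity (\sum_(u : F | u != 0) (gauss psi 1 ^+ 2) ^+ k * 
       \sum_t spectral_mass psi E t * \sum_(x : F) psi (u * (t - x ^+ 2))).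
      apply: eq_bigr => u u0; rewrite exprSr exprM gauss_sqr_const ?oppr_eq0 // -mulrA.
      congr (_ * _); rewrite /fourier mulr_sumr; apply: eq_bigr => t _.
      rewrite mulrCA; congr (_ * _); rewrite mulr_suml; apply: eq_bigr => x _.
      by rewrite -psiD; congr psi; ring.
    rewrite -mulr_sumr; congr (_ * _).
    rewrite exchange_big mulr_sumr; apply: eq_bigr => t _ /=.
    rewrite -mulr_sumr mulrCA; congr (_ * _).
    rewrite exchange_big /=.
    transitivity (\sum_(x : F) ((x ^+ 2 == t)%:R * Q - 1)).
      apply: eq_bigr => x _; have := sum_character psiD psi0 nontriv (t - x ^+ 2).
      rewrite (bigD1 0) //= mul0r psi0 subr_eq0 eq_sym => /(canRL (addKr _)) ->.
      by rewrite addrC.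
    rewrite big_split /= -mulr_suml -natr_sum sumr_const mulrBr mulr1 mulrC mulNrn.
    congr (Q * _%:R - _); rewrite -[RHS]sum1_card [RHS]big_mkcond.
    by apply: eq_bigr => x _; rewrite inE; case: (_ == _).
  have QK_gt0 : 0 < Q * K ^+ 2 by rewrite mulr_gt0 ?exprn_gt0.
  have absG : `|(gauss psi 1 ^+ 2) ^+ k| = K.
    rewrite normrX /K; congr (_ ^+ _).
    by case/orP: (gauss_sqr_sign oddF psiD psi0 nontriv) => /eqP ->; rewrite ?normrN gtr0_norm.
  rewrite exprS -/K -(ler_pM2l QK_gt0).
  rewrite -{1}(gtr0_norm QK_gt0) -normrM sumZ normrM absG normrM (gtr0_norm Q_gt0).
  have -> : Q * K ^+ 2 * (Q * K * N) = K * (Q * (Q * K ^+ 2 * N)) by ring.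
  rewrite !ler_pM2l // -Qd -(sum_spectral_mass psiD psi0 nontriv psiN).
  apply: le_trans (ler_norm_sum _ _ _) _; apply: ler_sum => t _.
  rewrite normrM ger0_norm ?spectral_mass_ge0 // ler_piMr ?spectral_mass_ge0 //.
  case: #|_| (card_sqrt_le2 t) => [|[|[|]]] // _.
  - by rewrite sub0r normrN normr1.
  - by rewrite subrr normr0 ler01.
  by rewrite mulrS addrAC subrr add0r normr1.
have := distance_correlation oddF psiD psi0 nontriv psiN E r0.
rewrite -/Q -/N Qd => corr.
have {}corr : Q * K ^+ 2 * (Q * \sum_t (distance_count E t)%:R * (distance_count E (r * t))%:R
    - N ^+ 4) = Q * \sum_t spectral_mass psi E t * spectral_mass psi E (r * t)
    - (Q * K ^+ 2 * N) ^+ 2.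
  by apply: corr => u u0; rewrite rb mulrC gauss_mul_square.
rewrite -/K -subr_ge0 -(pmulr_rge0 _ (_ : 0 < Q * K ^+ 2)); last first.
  by rewrite mulr_gt0 ?exprn_gt0.
rewrite -pmulrn natr_quadruple_count.
set S := \sum_t _ in corr *; set T := \sum_t _ in corr.
have -> : Q * K ^+ 2 * (Q * S - (N ^+ 4 - Q * K ^+ 2 * N ^+ 2)) =
  Q * K ^+ 2 * (Q * S - N ^+ 4) + (Q * K ^+ 2 * N) ^+ 2 by ring.
rewrite corr subrK; apply: mulr_ge0 (ltW Q_gt0) _; apply: sumr_ge0 => t _.
by rewrite mulr_ge0 ?spectral_mass_ge0.
Qed.

(** Here [w] stands for [e * z], so [e * w + n ^+ 2] is [q] times the count at distance 0. The terms
    in [w ^+ 2] cancel between its square and that of [K * n + w]; the linear ones are controlled by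
    the bounds on [K * n + w]. *)
Lemma quadruple_even_arith (q n K w e N : int) :
  3%:Z <= q -> 0 <= n -> 0 <= K -> 400%:Z * K ^+ 2 <= n ^+ 2 -> e ^+ 2 = 1 ->
  0 <= K * n + w -> K * n + w <= q * (K * n) ->
  (K * n + w) ^+ 2 - K ^+ 2 * q * n ^+ 2 <= q * (q * N - n ^+ 4) ->
  q * n ^+ 4 + 2%:Z * (e * w + n ^+ 2) ^+ 2 <= 2%:Z * (q * (q * N)).
Proof.
move=> q3 n0 K0 nK e2 w_ge w_le hN.
have nK' : 20%:Z * K <= n by nra.
have ew : e * w <= (q - 1) * (K * n).
  have /eqP := e2; rewrite sqrf_eq1 => /orP[]/eqP ->; first by lra.
  have : 0 <= (q - 2) * (K * n) by rewrite mulr_ge0 ?mulr_ge0 //; lra.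
  by lra.
have nKn : 20%:Z * (K * n) <= n ^+ 2.
  by rewrite expr2 mulrA ler_wpM2r.
(* This is what remains to be shown, divided by [n ^+ 2], after the linear terms in [w] have been
   estimated. *)
have main : 0 <= (q - 2) * n ^+ 2 - 4 * (q - 1) * (K * n) - (2 + 2 * q) * K ^+ 2.
  have : 0 <= (q - 1) * (n ^+ 2 - 20 * (K * n)) by rewrite mulr_ge0 //; lra.
  have : 0 <= (q + 1) * (n ^+ 2 - 400 * K ^+ 2) by rewrite mulr_ge0 //; lra.
  have : 0 <= (q - 3) * n ^+ 2 by rewrite mulr_ge0 ?sqr_ge0 //; lra.
  have := sqr_ge0 n.
  by lra.
have {}main : 0 <= n ^+ 2 * ((q - 2) * n ^+ 2 - 4 * (q - 1) * (K * n) - (2 + 2 * q) * K ^+ 2).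
  by rewrite mulr_ge0 ?sqr_ge0.
have : 0 <= 4 * n ^+ 2 * ((q - 1) * (K * n) - e * w).
  by rewrite !mulr_ge0 ?sqr_ge0 // subr_ge0.
have : 0 <= 4 * (K * n) * (K * n + w) by rewrite !mulr_ge0.
have -> : (e * w + n ^+ 2) ^+ 2 = e ^+ 2 * w ^+ 2 + 2 * e * w * n ^+ 2 + n ^+ 4 by ring.
rewrite e2; lra.
Qed.

Lemma quadruple_odd_arith (q n H z N : int) :
  3%:Z <= q -> 0 <= n -> 0 <= H -> 400%:Z * (q * H ^+ 2) <= n ^+ 2 ->
  `|z| <= q * H * n -> n ^+ 4 - q * H ^+ 2 * n ^+ 2 <= q * N ->
  q * n ^+ 4 + 2%:Z * (z + n ^+ 2) ^+ 2 <= 2%:Z * (q * (q * N)).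
Proof.
move=> q3 n0 H0 nH zle hN.
(* From [3 <= q] one gets [1200 * H ^+ 2 <= n ^+ 2], and [34 ^ 2 = 1156]. *)
have nH' : 34%:Z * H <= n.
  have : 0 <= (q - 3) * H ^+ 2 by rewrite mulr_ge0 ?sqr_ge0 //; lra.
  by nra.
have nHn : 34%:Z * (H * n) <= n ^+ 2 by rewrite expr2 mulrA ler_wpM2r.
have zn : (z + n ^+ 2) ^+ 2 <= (q * H * n + n ^+ 2) ^+ 2.
  have /andP[z1 z2] : - (q * H * n) <= z <= q * H * n by rewrite -ler_norml.
  have : 0 <= (q * H * n - z) * (q * H * n + z + 2 * n ^+ 2).
    by have := sqr_ge0 n; move=> n2; rewrite mulr_ge0 //; lra.
  by lra.
have main : 0 <= (q - 2) * n ^+ 2 - 4 * q ^+ 2 * H ^+ 2 - 4 * q * (H * n).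
  have : 0 <= q * (n ^+ 2 - 400 * (q * H ^+ 2)) by rewrite mulr_ge0 //; lra.
  have : 0 <= q * (n ^+ 2 - 34 * (H * n)) by rewrite mulr_ge0 //; lra.
  have : 0 <= (q - 3) * n ^+ 2 by rewrite mulr_ge0 ?sqr_ge0 //; lra.
  have := sqr_ge0 n.
  by lra.
have {}main : 0 <= n ^+ 2 * ((q - 2) * n ^+ 2 - 4 * q ^+ 2 * H ^+ 2 - 4 * q * (H * n)).
  by rewrite mulr_ge0 ?sqr_ge0.
have : q * (n ^+ 4 - q * H ^+ 2 * n ^+ 2) <= q * (q * N) by rewrite ler_wpM2l //; lra.
by lra.
Qed.

(** Removing the quadruples at distance 0 leaves at least [n ^ 4 / (2 q)] ordered edges of the
    dilation graph. *)
Lemma quadruple_count_lower (F : finFieldType) d (E : {set 'rV[F]_d}) (r : F) :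
    odd #|F| -> (if odd d then nz_square r else r != 0) ->
    (400 * #|F| ^ d <= #|E| ^ 2)%N ->
  (#|E| ^ 4 + 2 * #|F| * distance_count E 0%R ^ 2 <= 2 * #|F| * quadruple_count E r)%N.
Proof.
move=> oddF rP big.
have PoszX (a k : nat) : (a ^ k)%N%:Z = a%:Z ^+ k by rewrite -!natz natrX.
have q3 : (3 <= #|F|)%N.
  by have := finRing_gt1 F; move: oddF; case: #|F| => [|[|[|]]].
suff : #|F|%:Z * #|E|%:Z ^+ 4 + 2%:Z * (#|F|%:Z * (distance_count E 0)%:Z) ^+ 2
    <= 2%:Z * (#|F|%:Z * (#|F|%:Z * (quadruple_count E r)%:Z)).
  move=> h; rewrite -(leq_pmul2l (_ : 0 < #|F|)%N); last by apply: leq_trans q3.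
  move: h; move: #|F| #|E| (distance_count _ _) (quadruple_count _ _) => q n v N.
  by lia.
have {}big : 400%:Z * #|F|%:Z ^+ d <= #|E|%:Z ^+ 2.
  by rewrite -!PoszX -PoszM.
case: (boolP (odd d)) rP => dodd rP.
  have [k dk] : exists k, d = (2 * k).+1.
    by exists d./2; rewrite -[LHS]odd_double_half dodd mul2n.
  subst d; have [z_le hN] := quadruple_count_odd E oddF rP.
  rewrite [_ ^+ k.+1]exprS in z_le; rewrite exprS exprM exprAC in big.
  by have := quadruple_odd_arith _ _ _ big z_le hN; rewrite subrK; apply; rewrite ?exprn_ge0.
have [k dk] : exists k, d = (2 * k)%N.
  by exists d./2; rewrite -[LHS]odd_double_half (negbTE dodd) mul2n.
subst d; have [e [e2 z_ge z_le hN]] := quadruple_count_even E oddF rP.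
rewrite exprM exprAC in big.
(* Used with [w = e * z]; then [e * w = z] because [e ^+ 2 = 1]. *)
have := quadruple_even_arith _ _ _ big e2 z_ge z_le hN.
by rewrite mulrA -expr2 e2 mul1r subrK; apply; rewrite ?exprn_ge0.
Qed.

(** * Paths in the dilation graph *)

Definition dilation_adj (F : finFieldType) d (r : F) : rel ('rV[F]_d * 'rV[F]_d) :=
  fun p p' => (sqnorm (p.2 - p'.2) == r * sqnorm (p.1 - p'.1)) && (sqnorm (p.1 - p'.1) != 0).

Lemma sqnormB_sym (F : fieldType) d (x y : 'rV[F]_d) : sqnorm (x - y) = sqnorm (y - x).
Proof. by apply: eq_bigr => i _; rewrite !mxE -opprB sqrrN. Qed.

Lemma dilation_adj_sym (F : finFieldType) d (r : F) : symmetric (@dilation_adj F d r).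
Proof.
by move=> p p'; rewrite /dilation_adj sqnormB_sym [sqnorm (p.1 - _)]sqnormB_sym.
Qed.

(** The term [t = 0] of the correlation is the square on the left; the terms [t != 0] count edges,
    grouped by the pair of first coordinates. *)
Lemma sum_dilation_adj (F : finFieldType) d (E : {set 'rV[F]_d}) (r : F) :
  (\sum_(p in setX E E) \sum_(p' in setX E E) dilation_adj r p p'
     + distance_count E 0%R ^ 2 = quadruple_count E r)%N.
Proof.
rewrite /quadruple_count (bigD1 0) //= mulr0 addnC mulnn; congr (_ + _)%N.
transitivity (\sum_(x in E) \sum_(x' in E)
    (sqnorm (x - x') != 0%R) * distance_count E (r * sqnorm (x - x'))%R)%N; last first.
  under [RHS]eq_bigr do rewrite big_distrl /=.
  rewrite [RHS]exchange_big; apply: eq_bigr => x _.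
  under [RHS]eq_bigr do rewrite big_distrl /=.
  rewrite [RHS]exchange_big; apply: eq_bigr => x' _.
  have [-> | nz] := eqVneq (sqnorm (x - x')) 0.
    by rewrite mul0n big1 // => t; rewrite eq_sym => /negbTE ->.
  rewrite (bigD1 (sqnorm (x - x'))) //= eqxx big1 ?addn0 // => t /andP[_].
  by rewrite eq_sym => /negbTE ->.
have setXE (f : 'rV[F]_d * 'rV[F]_d -> nat) :
    (\sum_(p in setX E E) f p = \sum_(x in E) \sum_(y in E) f (x, y))%N.
  by rewrite pair_big /=; apply: eq_big => [[x y]|[x y] _]; rewrite ?inE.
rewrite setXE; apply: eq_bigr => x _.
under eq_bigr do rewrite setXE.
rewrite exchange_big; apply: eq_bigr => x' _.
rewrite /distance_count big_distrr; apply: eq_bigr => y _ /=.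
rewrite big_distrr; apply: eq_bigr => y' _ /=.
by rewrite /dilation_adj /= mulnC mulnb.
Qed.

(* Take a smallest subset keeping this edge density: deleting one of its vertices
   must cost more than the average. *)
Lemma dense_subgraph (T : finType) (e : rel T) (P : {set T}) (delta : nat) :
  symmetric e -> irreflexive e ->
  (2 * delta * #|P| < \sum_(p in P) \sum_(p' in P) e p p')%N ->
  exists U : {set T}, [/\ U \subset P, U != set0 &
    forall p, p \in U -> (delta < #|[set p' in U | e p p']|)%N].
Proof.
move=> esym eirr dense.
pose Q (U : {set T}) := (U \subset P) && (2 * delta * #|U| < \sum_(p in U) \sum_(p' in U) e p p')%N.
have QP : Q P by rewrite /Q subxx.
case: (arg_minnP (fun U : {set T} => #|U|) QP) => U /andP[UP Udense] Umin.
exists U; split=> //.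
  by apply: contraTneq Udense => ->; rewrite big_set0.
move=> p pU; rewrite ltnNge; apply/negP => deg_le.
suff : Q (U :\ p) by move/Umin; rewrite (cardsD1 p U) pU ltnn.
rewrite /Q (subset_trans (subsetDl _ _) UP) /=.
have degE : (#|[set p' in U | e p p']| = \sum_(p' in U :\ p) e p p')%N.
  rewrite -sum1_card (eq_bigl (fun p' => (p' \in U) && e p p')) => [|p']; last by rewrite inE.
  rewrite big_mkcondr (big_setD1 p) //= eirr add0n.
  by apply: eq_bigr => p' _; case: (e p p').
(* Edges are ordered, so deleting [p] costs twice its degree; this is the factor 2 in the
   density. *)
have sumE : (\sum_(x in U) \sum_(y in U) e x y = 2 * (\sum_(y in U :\ p) e p y)
    + \sum_(x in U :\ p) \sum_(y in U :\ p) e x y)%N.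
  rewrite (big_setD1 p) //= (big_setD1 p pU) /= eirr add0n mul2n -addnn -addnA.
  congr (_ + _)%N; rewrite -big_split; apply: eq_bigr => x _ /=.
  by rewrite (big_setD1 p pU) /= esym.
by move: Udense deg_le; rewrite (cardsD1 p U) pU degE sumE; lia.
Qed.

Lemma card_fibers_le (T : finType) (A : eqType) (f : T -> A) (D : {set T}) (c : nat) (l : seq A) :
  (forall a, #|[set x in D | f x == a]| <= c)%N ->
  (#|[set x in D | f x \in l]| <= size l * c)%N.
Proof.
move=> fib; elim: l => [|a l IHl].
  by rewrite leqn0 cards_eq0; apply/eqP/setP => x; rewrite !inE andbF.
have -> : [set x in D | f x \in a :: l] = [set x in D | f x == a] :|: [set x in D | f x \in l].
  by apply/setP => x; rewrite !inE andb_orr.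
by rewrite mulSn (leq_trans (leq_card_setU _ _)) // leq_add.
Qed.

(** The path grows at its head. A path on [k + 1] vertices excludes at most [(k + 1) * c] neighbours
    of its head through first coordinates and as many through second ones, fewer than the degree
    assumed for the next length. *)
Lemma greedy_path (A B : finType) (e : rel (A * B)) (U : {set A * B}) (c k : nat) :
    symmetric e -> U != set0 ->
    (forall p a, (#|[set p' in [set p' | e p p'] | p'.1 == a]| <= c)%N) ->
    (forall p b, (#|[set p' in [set p' | e p p'] | p'.2 == b]| <= c)%N) ->
    (forall p, p \in U -> (2 * k * c < #|[set p' in U | e p p']|)%N) ->
  exists s : seq (A * B), [/\ size s = k.+1, path.sorted e s,
    uniq (map fst s), uniq (map snd s) & {subset s <= U}].
Proof.
move=> esym U0 fib1 fib2; elim: k => [|k IHk] deg.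
  case/set0Pn: U0 => p pU; exists [:: p]; split=> // x.
  by rewrite inE => /eqP ->.
case: IHk => [p pU|[|p s] [sz srt u1 u2 sU] //].
  by apply: leq_ltn_trans (deg p pU); rewrite leq_mul2r leq_mul2l leqnSn !orbT.
pose bad1 := [set p' in [set p' | e p p'] | p'.1 \in map fst (p :: s)].
pose bad2 := [set p' in [set p' | e p p'] | p'.2 \in map snd (p :: s)].
have bad_lt : (#|bad1 :|: bad2| < #|[set p' in U | e p p']|)%N.
  apply: leq_ltn_trans (deg p (sU p (mem_head _ _))).
  apply: leq_trans (leq_card_setU _ _) _.
  rewrite -mulnA mul2n -addnn leq_add //.
    by apply: leq_trans (card_fibers_le _ (fib1 p)) _; rewrite size_map sz.
  by apply: leq_trans (card_fibers_le _ (fib2 p)) _; rewrite size_map sz.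
have : ~~ ([set p' in U | e p p'] \subset bad1 :|: bad2).
  by apply/negP => /subset_leq_card; rewrite leqNgt bad_lt.
case/subsetPn => p'; rewrite !inE => /andP[p'U epp'].
rewrite epp' /= negb_or => /andP[n1 n2].
exists [:: p', p & s]; split=> //.
- by rewrite /= -sz.
- by rewrite /= esym epp'.
- by rewrite map_cons cons_uniq u1 andbT inE.
- by rewrite map_cons cons_uniq u2 andbT inE.
by move=> x; rewrite inE => /predU1P[-> //|]; apply: sU.
Qed.

(** Once all coordinates but the first are chosen, the square of the first difference is determined,
    which leaves at most two values. *)
Lemma card_sphere (F : finFieldType) d (v : 'rV[F]_d.+1) (t : F) :
  (#|[set y | sqnorm (v - y) == t]| <= 2 * #|F| ^ d)%N.
Proof.
pose tail (y : 'rV[F]_d.+1) : 'rV[F]_d := \row_i y ord0 (lift ord0 i).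
rewrite -sum1_card (partition_big tail predT) //=.
have -> : (2 * #|F| ^ d = \sum_(w : 'rV[F]_d) 2)%N.
  by rewrite sum_nat_const card_mx mul1n mulnC.
apply: leq_sum => w _; rewrite sum1dep_card.
pose h (y : 'rV[F]_d.+1) := v ord0 ord0 - y ord0 ord0.
pose c := t - \sum_i (v ord0 (lift ord0 i) - w ord0 i) ^+ 2.
apply: leq_trans (card_sqrt_le2 c); rewrite -(card_in_imset (f := h)).
  apply: subset_leq_card; apply/subsetP => _ /imsetP[y + ->].
  rewrite !inE => /andP[/eqP yt /eqP yw]; apply/eqP.
  rewrite /c -yt -yw /sqnorm big_ord_recl !mxE -[LHS]addr0 -addrA; congr (_ + _).
  by rewrite -sumrB big1 // => i _; rewrite !mxE subrr.
move=> y y'; rewrite !inE => /andP[_ /eqP yw] /andP[_ /eqP y'w] /addrI/oppr_inj hy.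
apply/rowP => i; case: (unliftP ord0 i) => [j ->|->] //.
by have /rowP/(_ j) := etrans yw (esym y'w); rewrite !mxE.
Qed.

Lemma contains_4path_pair_of_large (F : finFieldType) d (E : {set 'rV[F]_d}) (r : F) :
    odd #|F| -> (0 < d)%N -> (if odd d then nz_square r else r != 0) ->
    (400 * #|F| ^ d <= #|E| ^ 2)%N -> contains_4path_pair E r.
Proof.
case: d E => // d E oddF _ rP big.
have r0 : r != 0 by move: rP; case: ifP => // _ [].
have F0 : (0 < #|F|)%N by apply: leq_trans (finRing_gt1 F).
pose e := @dilation_adj F d.+1 r.
have esym : symmetric e by exact: dilation_adj_sym.
have e_neq p p' : e p p' -> sqnorm (p.1 - p'.1) != 0 by case/andP.
have eirr : irreflexive e.
  move=> p; apply: contraTF isT => /e_neq; rewrite subrr /sqnorm big1 ?eqxx // => i _.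
  by rewrite mxE expr0n.
(* Fixing one coordinate of a neighbour confines the other one to a sphere; this supplies the fibre
   bounds of [greedy_path]. *)
have sph p (c t : F) (f : 'rV[F]_d.+1 * 'rV[F]_d.+1 -> 'rV[F]_d.+1) (D : {set _}) :
    {in D &, injective f} -> (forall p', p' \in D -> sqnorm (p - f p') = t) ->
    (#|D| <= 2 * #|F| ^ d)%N.
  move=> f_inj fD; rewrite -(card_in_imset f_inj); apply: leq_trans (card_sphere p t).
  by apply: subset_leq_card; apply/subsetP => _ /imsetP[p' p'D ->]; rewrite inE fD.
(* A path with 4 edges and fibres of size at most [2 q ^ d] (the dimension is [d.+1]) asks for
   degrees above [16 q ^ d], hence for an average above [32 q ^ d]; the edge count provides
   [200 q ^ d]. *)
have dense : (2 * (2 * 4 * (2 * #|F| ^ d)) * #|setX E E| <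
    \sum_(p in setX E E) \sum_(p' in setX E E) e p p')%N.
  have := quadruple_count_lower oddF rP big; rewrite -sum_dilation_adj -/e cardsX.
  have : (0 < #|F| ^ d)%N by rewrite expn_gt0 F0.
  move: big; rewrite expnS.
  set M := (\sum_(p in _) _)%N; move: (distance_count E 0%R) (#|F| ^ d)%N => v Q.
  move=> big Q0 low.
  have n0 : (0 < #|E|)%N by rewrite lt0n; apply: contraTneq big => ->; rewrite -ltnNge; lia.
  have low' : (#|E| ^ 4 <= 2 * #|F| * M)%N by lia.
  have : (400 * (#|F| * Q) * #|E| ^ 2 <= #|E| ^ 2 * #|E| ^ 2)%N by rewrite leq_mul2r big orbT.
  rewrite -expnD => /leq_trans/(_ low') ?.
  have : (200 * Q * #|E| ^ 2 <= M)%N.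
    by rewrite -(leq_pmul2l (_ : 0 < 2 * #|F|)%N) ?muln_gt0 //; lia.
  apply: leq_trans; rewrite -mulnn.
  have : (0 < Q * (#|E| * #|E|))%N by rewrite !muln_gt0 Q0 n0.
  lia.
have [U [UP U0 deg]] := dense_subgraph esym eirr dense.
have [||s [sz srt u1 u2 sU]] := greedy_path esym U0 _ _ deg.
- move=> p a; apply: (sph p.2 0 (r * sqnorm (p.1 - a)) snd).
    by move=> [x y] [x' y']; rewrite !inE => /andP[_ /eqP/= ->] /andP[_ /eqP/= ->] ->.
  by move=> [x y]; rewrite !inE => /andP[/andP[/eqP ? _] /eqP <-].
- move=> p b; apply: (sph p.1 0 (r^-1 * sqnorm (p.2 - b)) fst).
    by move=> [x y] [x' y']; rewrite !inE => /andP[_ /eqP/= ->] /andP[_ /eqP/= ->] ->.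
  by move=> [x y]; rewrite !inE => /andP[/andP[/eqP h _] /eqP <-]; rewrite h mulKf.
(* As [s] has size 5, the default 0 of [nth] is never returned. *)
have nthE i : (i < 5)%N -> nth 0 s i \in setX E E.
  by move=> i5; rewrite (subsetP UP) // sU // mem_nth // sz.
exists (fun i => (nth 0 s i).1), (fun i => (nth 0 s i).2); split.
- move=> i j; rewrite -!(nth_map _ 0) ?sz // => /eqP.
  by rewrite nth_uniq ?size_map ?sz // => /eqP/val_inj.
- move=> i j; rewrite -!(nth_map _ 0) ?sz // => /eqP.
  by rewrite nth_uniq ?size_map ?sz // => /eqP/val_inj.
- by move=> i; have := nthE i (ltn_ord i); rewrite inE => /andP.
have step (i j : 'I_5) : i.+1 = j -> e (nth 0 s i) (nth 0 s j).
  by move=> ij; rewrite -ij; apply: (elimT (path.sortedP 0) srt); rewrite ij sz.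
move=> i j /orP[]/eqP ij.
  by have /andP[/eqP] := step i j ij.
by have := step j i ij; rewrite esym => /andP[/eqP].
Qed.

(** * From real powers to natural numbers *)

Lemma INR_expn m k : Reals.Raxioms.INR (m ^ k) = Reals.Rpow_def.pow (Reals.Raxioms.INR m) k.
Proof. by elim: k => //= k IHk; rewrite expnS Reals.RIneq.mult_INR IHk. Qed.

(** Both sides are raised to the power [den], which clears the fractional exponent; as a successor
    [den] is nonzero. *)
Lemma size_ge_nat (n c q num k : nat) (den := k.+1) : (0 < q)%N ->
  size_ge n c q num den -> (c ^ den * q ^ num <= n ^ den)%N.
Proof.
move=> q0 h; apply/ssrnat.leP/Reals.RIneq.INR_le.
have Rq0 : Reals.Rdefinitions.Rlt (Reals.Rdefinitions.IZR BinNums.Z0) (Reals.Raxioms.INR q).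
  by apply: Reals.RIneq.lt_0_INR; apply/ssrnat.ltP.
have Rden : Reals.Raxioms.INR den <> Reals.Rdefinitions.IZR BinNums.Z0.
  by apply: Reals.RIneq.not_0_INR.
rewrite Reals.RIneq.mult_INR !INR_expn.
have -> : Reals.Rpow_def.pow (Reals.Raxioms.INR q) num =
    Reals.Rpow_def.pow (Reals.Rpower.Rpower (Reals.Raxioms.INR q)
      (Reals.Rdefinitions.Rdiv (Reals.Raxioms.INR num) (Reals.Raxioms.INR den))) den.
  rewrite -[RHS]Reals.Rpower.Rpower_pow; last exact: Reals.RIneq.Rgt_lt (Reals.Exp_prop.exp_pos _).
  rewrite Reals.Rpower.Rpower_mult /Reals.Rdefinitions.Rdiv Reals.Raxioms.Rmult_assoc.
  by rewrite Reals.Raxioms.Rinv_l // Reals.RIneq.Rmult_1_r Reals.Rpower.Rpower_pow.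
rewrite -Reals.Rfunctions.Rpow_mult_distr; apply: Reals.Rfunctions.pow_incr; split=> //.
apply: Reals.RIneq.Rmult_le_pos; first exact: Reals.RIneq.pos_INR.
exact: Reals.RIneq.Rlt_le (Reals.Exp_prop.exp_pos _).
Qed.

Theorem theorem1p6 (F : finFieldType) (d : nat) (E : {set 'rV[F]_d}) (r : F) :
  odd #|F| ->
  [/\ (5 <= #|F|)%N -> (d = 2%N \/ d = 4%N) -> r != 0 ->
        size_ge #|E| 36 #|F| (2 * d + 1) 3 -> contains_4path_pair E r,
      d = 3%N -> nz_square r ->
        size_ge #|E| 9 #|F| (2 * d + 1) 3 -> contains_4path_pair E r,
      d = 5%N -> nz_square r ->
        size_ge #|E| 12 #|F| 3 1 -> contains_4path_pair E r,
      (5 <= #|F|)%N -> (6 <= d)%N -> ~~ odd d -> r != 0 ->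
        size_ge #|E| 313 #|F| d 2 -> contains_4path_pair E r &
      (7 <= d)%N -> odd d -> nz_square r ->
        size_ge #|E| 313 #|F| d 2 -> contains_4path_pair E r].
Proof.
move=> oddF.
have q3 : (3 <= #|F|)%N.
  by have := finRing_gt1 F; move: oddF; case: #|F| => [|[|[|]]].
have q0 : (0 < #|F|)%N by apply: leq_trans q3.
have large_enough : (313 ^ 2 * #|F| ^ d <= #|E| ^ 2 -> 400 * #|F| ^ d <= #|E| ^ 2)%N.
  by apply: leq_trans; rewrite leq_mul2r; apply/orP; right; lia.
split.
- move=> _ d24 r0 /(size_ge_nat q0) big; apply: contains_4path_pair_of_large => //.
  + by case: d24 => ->.
  + by case: d24 => ->.
  (* As [400 = 20 ^ 2] and [d] is even, [20 * q ^ (d / 2) <= n] suffices. In cubes it follows from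
     [20 <= 36] and [3 d / 2 <= 2 d + 1]. *)
  suff n_ge : (20 ^ 3 * (#|F| ^ d./2) ^ 3 <= #|E| ^ 3)%N.
    have dE : d = (d./2 * 2)%N by case: d24 => ->.
    have -> : (400 * #|F| ^ d = (20 * #|F| ^ d./2) ^ 2)%N by rewrite expnMn -expnM -dE.
    by rewrite leq_exp2r // -(@leq_exp2r _ _ 3) // expnMn.
  apply: leq_trans big; rewrite leq_mul // -expnM leq_pexp2l //.
  by case: d24 => ->.
- move=> d3 rsq /(size_ge_nat q0) big; apply: contains_4path_pair_of_large => //.
  + by rewrite d3.
  + by rewrite d3.
  rewrite -(@leq_exp2r _ _ 3) // expnMn.
  have -> : ((#|E| ^ 2) ^ 3 = #|E| ^ 3 * #|E| ^ 3)%N by rewrite -expnM -expnD.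
  apply: leq_trans (leq_mul big big); rewrite [leqRHS]mulnACA -[(#|F| ^ _ * _)%N]expnD -expnM d3.
  (* Splitting [q ^ 14] as [q ^ 5 * q ^ 9] leaves [400 ^ 3 <= 9 ^ 6 * q ^ 5], which holds since
     [3 ^ 5 <= q ^ 5]. *)
  have -> : (2 * 3 + 1 + (2 * 3 + 1) = 5 + 3 * 3)%N by [].
  rewrite [(#|F| ^ (_ + _))%N]expnD [leqRHS]mulnA leq_mul2r; apply/orP; right.
  have : (3 ^ 5 <= #|F| ^ 5)%N by rewrite leq_exp2r.
  by move: (#|F| ^ 5)%N => Q; lia.
- move=> d5 rsq /(size_ge_nat q0); rewrite !expn1 => big.
  apply: contains_4path_pair_of_large => //; rewrite ?d5 //.
  have -> : (#|E| ^ 2 = #|E| * #|E|)%N by [].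
  apply: leq_trans (leq_mul big big).
  (* With [3 <= q] one has [144 q ^ 6 >= 432 q ^ 5], enough for the constant 400. *)
  have : (3 * #|F| ^ 5 <= #|F| ^ 3 * #|F| ^ 3)%N by rewrite -expnD expnS leq_mul2r q3 orbT.
  by rewrite d5; move: (#|F| ^ 5)%N (#|F| ^ 3)%N => A B; lia.
- move=> _ d6 dev r0 /(size_ge_nat q0)/large_enough big.
  by apply: contains_4path_pair_of_large; rewrite ?(negbTE dev) // (leq_trans _ d6).
move=> d7 dodd rsq /(size_ge_nat q0)/large_enough big.
by apply: contains_4path_pair_of_large; rewrite ?dodd // (leq_trans _ d7).
Qed.
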